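(* Let $(\mathcal X,\mathcal Y)$ be an admissible balanced pair in an abelian category $\mathcal A$. Then the following statements are equivalent for any $N\in\mathcal A$ and any integer $n\ge 0$. (1) $\mathcal Y\text{-}\operatorname{cores.dim} N\le n$. (2) $\operatorname{Ext}_\ast^{i}(M,N)=0$ for all $i\ge n+1$ and all $M\in\mathcal A$. (3) $\operatorname{Ext}_\ast^{n+1}(M,N)=0$ for all $M\in\mathcal A$. (4) For any $\mathcal Y$-coresolution $0\to N\xrightarrow{d_Y^{-1}}Y^0\xrightarrow{d_Y^0}Y^1\to\cdots$ of $N$ (with $d_Y^{-1}$ the coaugmentation), one has $\operatorname{Im} d_Y^{n-1}\in\mathcal Y$.
   Context: $\mathcal A$ is an abelian category; a subcategory of $\mathcal A$ means a full additive subcategory closed under isomorphisms and direct summands. A morphism $f:X\to M$ with $X\in\mathcal X$ is a right $\mathcal X$-approximation of $M$ if every morphism $X'\to M$ with $X'\in\mathcal X$ factors through $f$; $\mathcal X$ is contravariantly finite in $\mathcal A$ if every object of $\mathcal A$ has a right $\mathcal X$-approximation. Left approximations and covariantly finite subcategories are defined dually. A complex $A^\bullet$ in $\mathcal A$ is right $\mathcal X$-acyclic if $\operatorname{Hom}_{\mathcal A}(X,A^\bullet)$ is acyclic for all $X\in\mathcal X$, and left $\mathcal X$-acyclic if $\operatorname{Hom}_{\mathcal A}(A^\bullet,X)$ is acyclic for all $X\in\mathcal X$. For $\mathcal X$ contravariantly finite, an $\mathcal X$-resolution of $M$ is a right $\mathcal X$-acyclic complex $\cdots\to X^{-1}\to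 X^0\to M\to 0$ with all $X^i\in\mathcal X$; the complex $X^\bullet=(\cdots\to X^{-1}\to X^0\to 0)$ is the deleted resolution. For $\mathcal Y$ covariantly finite, a $\mathcal Y$-coresolution of $N$ is a left $\mathcal Y$-acyclic complex $0\to N\to Y^0\to Y^1\to\cdots$ with all $Y^i\in\mathcal Y$, with deleted coresolution $Y^\bullet=(0\to Y^0\to Y^1\to\cdots)$. $\mathcal Y\text{-}\operatorname{cores.dim}N$ is the minimal $n\ge0$ such that there is a $\mathcal Y$-coresolution $0\to N\to Y^0\to\cdots\to Y^n\to0$, and $\infty$ if none exists. A pair $(\mathcal X,\mathcal Y)$ of subcategories is a balanced pair if $\mathcal X$ is contravariantly finite, $\mathcal Y$ is covariantly finite, every $M\in\mathcal A$ has an $\mathcal X$-resolution that is left $\mathcal Y$-acyclic, and every $N\in\mathcal A$ has a $\mathcal Y$-coresolution that is right $\mathcal X$-acyclic. It is admissible if every right $\mathcal X$-approximation is an epimorphism (equivalently, every left $\mathcal Y$-approximation is a monomorphism). For $M,N\in\mathcal A$ put $\operatorname{Ext}_\ast^i(M,N):=H^i(\operatorname{Hom}_{\mathcal A}(X^\bullet,N))\cong H^i(\operatorname{Hom}_{\mathcal A}(M,Y^\bullet))$, where $X^\bullet\to M$ is an $\mathcal X$-resolution and $N\to Y^\bullet$ a $\mathcal Y$-coresolution (independent of choices). *)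

(* Defs.v *)
From HB Require Import structures.
From mathcomp Require Import all_boot all_order all_algebra.
From mathcomp Require Import boolp.

Set Implicit Arguments.
Unset Strict Implicit.
Unset Printing Implicit Defensive.

Import GRing.Theory.
Local Open Scope ring_scope.

Reserved Notation "g \oc f" (at level 40, left associativity).

Record preadditive := Preadditive {
  obj :> Type;
  Hom : obj -> obj -> zmodType;
  idm : forall A, Hom A A;
  comp : forall A B D, Hom B D -> Hom A B -> Hom A D;
  compA : forall A B D E (h : Hom D E) (g : Hom B D) (f : Hom A B),
    comp h (comp g f) = comp (comp h g) f;
  comp1m : forall A B (f : Hom A B), comp (idm B) f = f;
  compm1 : forall A B (f : Hom A B), comp f (idm A) = f;
  compDl : forall A B D (g g' : Hom B D) (f : Hom A B),
    comp (g + g') f = comp g f + comp g' f;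
  compDr : forall A B D (g : Hom B D) (f f' : Hom A B),
    comp g (f + f') = comp g f + comp g f'
}.
Arguments Hom {p} A B.
Arguments idm {p} A.
Arguments comp {p A B D} g f.

Notation "g \oc f" := (comp g f) : ring_scope.

Section Preadditive.
Variable C : preadditive.
Implicit Types A B D M N Z : C.

Definition mono A B (f : Hom A B) : Prop :=
  forall T (u v : Hom T A), f \oc u = f \oc v -> u = v.

Definition epi A B (f : Hom A B) : Prop :=
  forall T (u v : Hom B T), u \oc f = v \oc f -> u = v.

Definition isomorphic A B : Prop :=
  exists (f : Hom A B) (g : Hom B A), g \oc f = idm A /\ f \oc g = idm B.

(* Hom-sets are groups, hence inhabited: a unique morphism is the zero one. *)
Definition is_zero Z : Prop :=
  (forall A (f : Hom Z A), f = 0) /\ (forall A (f : Hom A Z), f = 0).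

Definition is_biproduct A B P (i1 : Hom A P) (i2 : Hom B P)
    (p1 : Hom P A) (p2 : Hom P B) : Prop :=
  [/\ p1 \oc i1 = idm A, p2 \oc i2 = idm B, p1 \oc i2 = 0, p2 \oc i1 = 0
    & i1 \oc p1 + i2 \oc p2 = idm P].

Definition is_direct_sum A B P : Prop :=
  exists (i1 : Hom A P) (i2 : Hom B P) (p1 : Hom P A) (p2 : Hom P B),
    is_biproduct i1 i2 p1 p2.

Definition is_kernel A B (f : Hom A B) K (k : Hom K A) : Prop :=
  f \oc k = 0 /\
  forall T (u : Hom T A), f \oc u = 0 -> exists! v : Hom T K, k \oc v = u.

Definition is_cokernel A B (f : Hom A B) Q (q : Hom B Q) : Prop :=
  q \oc f = 0 /\
  forall T (u : Hom B T), u \oc f = 0 -> exists! v : Hom Q T, v \oc q = u.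

Definition postcomp T A B (f : Hom A B) (u : Hom T A) : Hom T B := f \oc u.

Definition precomp T A B (f : Hom A B) (u : Hom B T) : Hom A T := u \oc f.

Lemma postcomp_is_zmod_morphism T A B (f : Hom A B) :
  zmod_morphism (@postcomp T A B f).
Proof.
by move=> u v; apply: (addIr (f \oc v)); rewrite /postcomp -compDr !subrK.
Qed.

HB.instance Definition _ T A B (f : Hom A B) :=
  GRing.isZmodMorphism.Build _ _ (@postcomp T A B f)
    (@postcomp_is_zmod_morphism T A B f).

Lemma precomp_is_zmod_morphism T A B (f : Hom A B) :
  zmod_morphism (@precomp T A B f).
Proof.
by move=> u v; apply: (addIr (v \oc f)); rewrite /precomp -compDl !subrK.
Qed.

HB.instance Definition _ T A B (f : Hom A B) :=
  GRing.isZmodMorphism.Build _ _ (@precomp T A B f)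
    (@precomp_is_zmod_morphism T A B f).

End Preadditive.

Arguments postcomp {C} T {A B} f.
Arguments precomp {C} T {A B} f.

Record abelian := Abelian {
  abelian_base :> preadditive;
  zero_ex : exists Z : abelian_base, is_zero Z;
  direct_sum_ex : forall A B : abelian_base,
    exists P : abelian_base, is_direct_sum A B P;
  Ker : forall A B : abelian_base, Hom A B -> abelian_base;
  ker : forall (A B : abelian_base) (f : Hom A B), Hom (Ker f) A;
  kerP : forall (A B : abelian_base) (f : Hom A B), is_kernel f (ker f);
  Coker : forall A B : abelian_base, Hom A B -> abelian_base;
  coker : forall (A B : abelian_base) (f : Hom A B), Hom B (Coker f);
  cokerP : forall (A B : abelian_base) (f : Hom A B), is_cokernel f (coker f);
  mono_normal : forall (A B : abelian_base) (f : Hom A B), mono f ->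
    exists (D : abelian_base) (g : Hom B D), is_kernel g f;
  epi_normal : forall (A B : abelian_base) (f : Hom A B), epi f ->
    exists (D : abelian_base) (g : Hom D A), is_cokernel g f
}.
Arguments Ker {a A B} f.
Arguments ker {a A B} f.
Arguments Coker {a A B} f.
Arguments coker {a A B} f.

Definition Im (C : abelian) (A B : C) (f : Hom A B) : C := Ker (coker f).

Section GroupComplexes.

Definition exact_at (U V W : zmodType) (f : U -> V) (g : V -> W) : Prop :=
  forall v, g v = 0 <-> exists u, f u = v.

(* ... -> G 2 -> G 1 -> G 0 -> 0 *)
Definition chain_acyclic (G : nat -> zmodType)
    (d : forall i, G i.+1 -> G i) : Prop :=
  (forall y, exists x, d 0%N x = y) /\ forall i, exact_at (d i.+1) (d i).

(* 0 -> G 0 -> G 1 -> G 2 -> ... *)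
Definition cochain_acyclic (G : nat -> zmodType)
    (d : forall i, G i -> G i.+1) : Prop :=
  (forall x, d 0%N x = 0 -> x = 0) /\ forall i, exact_at (d i) (d i.+1).

Section Homology.
Variables (U V W : zmodType) (f : {additive U -> V}) (g : {additive V -> W}).

Definition cycle_pred : {pred V} := fun v => g v == 0.

Lemma cycle_zmod_closed : zmod_closed cycle_pred.
Proof.
split=> [|u v]; rewrite !unfold_in ?raddf0 // => /eqP gu /eqP gv.
by rewrite raddfB gu gv subrr.
Qed.

HB.instance Definition _ :=
  GRing.isZmodClosed.Build V cycle_pred cycle_zmod_closed.

Record cycle := Cycle { cycle_val : V; _ : cycle_val \in cycle_pred }.

HB.instance Definition _ := [isSub for cycle_val].
HB.instance Definition _ := [Choice of cycle by <:].
HB.instance Definition _ := [SubChoice_isSubZmodule of cycle by <:].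

Definition boundary_pred : {pred cycle} :=
  fun z => `[< exists u, f u = cycle_val z >].

Lemma boundary_zmod_closed : zmod_closed boundary_pred.
Proof.
split=> [|y z]; rewrite !unfold_in.
  by apply/asboolP; exists 0; rewrite raddf0.
move=> /asboolP[u fu] /asboolP[v fv]; apply/asboolP.
by exists (u - v); rewrite raddfB fu fv.
Qed.

HB.instance Definition _ :=
  GRing.isZmodClosed.Build cycle boundary_pred boundary_zmod_closed.

(* Ker g / Im f for U -f-> V -g-> W with g \o f = 0 *)
Definition homology : zmodType := Quotient.quot boundary_pred.

Lemma homology_eq0 :
  (forall x : homology, x = 0) <->
  (forall v, g v = 0 -> exists u, f u = v).
Proof.
split=> [H0 v /eqP gv|ex x].
  have : (\pi_(Quotient.quot boundary_pred) (Cycle gv) ==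
          \pi_(Quotient.quot boundary_pred) 0)%qT.
    by rewrite [X in X == _]H0 [X in _ == X]H0.
  by rewrite -Quotient.idealrBE subr0 unfold_in => /asboolP.
rewrite -[x]reprK; case: (repr x) => v gv.
rewrite -[RHS](raddf0 (\pi_(Quotient.quot boundary_pred))%qT).
apply/eqP; rewrite -Quotient.idealrBE subr0 unfold_in; apply/asboolP.
by apply: ex; apply/eqP.
Qed.

End Homology.

End GroupComplexes.

Section Relative.
Variable C : abelian.
Implicit Types A B D M N T Z : C.

Record subcategory := Subcategory {
  mem_sub :> C -> Prop;
  sub_zero : forall Z, is_zero Z -> mem_sub Z;
  sub_direct_sum : forall A B P : C,
    is_direct_sum A B P -> mem_sub A -> mem_sub B -> mem_sub P;
  sub_iso : forall A B : C, isomorphic A B -> mem_sub A -> mem_sub B;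
  sub_summand : forall A B P : C, is_direct_sum A B P -> mem_sub P -> mem_sub A
}.
Implicit Types X Y : subcategory.

Definition right_approximation X M A (f : Hom A M) : Prop :=
  X A /\ forall A' (g : Hom A' M), X A' -> exists h : Hom A' A, f \oc h = g.

Definition left_approximation Y N B (f : Hom N B) : Prop :=
  Y B /\ forall B' (g : Hom N B'), Y B' -> exists h : Hom B B', h \oc f = g.

Definition contravariantly_finite X : Prop :=
  forall M, exists A (f : Hom A M), right_approximation X f.

Definition covariantly_finite Y : Prop :=
  forall N, exists B (f : Hom N B), left_approximation Y f.

(* ... -> A 2 -> A 1 -> A 0 -> 0 *)
Record chain_complex := ChainComplex {
  ch_obj :> nat -> C;
  ch_d : forall i, Hom (ch_obj i.+1) (ch_obj i);
  ch_dd : forall i, ch_d i \oc ch_d i.+1 = 0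
}.

(* 0 -> A 0 -> A 1 -> A 2 -> ... *)
Record cochain_complex := CochainComplex {
  co_obj :> nat -> C;
  co_d : forall i, Hom (co_obj i) (co_obj i.+1);
  co_dd : forall i, co_d i.+1 \oc co_d i = 0
}.

Definition ch_right_acyclic X (A : chain_complex) : Prop :=
  forall T, X T ->
    chain_acyclic (G := fun i => Hom T (A i)) (fun i => postcomp T (ch_d A i)).

Definition ch_left_acyclic Y (A : chain_complex) : Prop :=
  forall T, Y T ->
    cochain_acyclic (G := fun i => Hom (A i) T) (fun i => precomp T (ch_d A i)).

Definition co_right_acyclic X (A : cochain_complex) : Prop :=
  forall T, X T ->
    cochain_acyclic (G := fun i => Hom T (A i)) (fun i => postcomp T (co_d A i)).

Definition co_left_acyclic Y (A : cochain_complex) : Prop :=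
  forall T, Y T ->
    chain_acyclic (G := fun i => Hom (A i) T) (fun i => precomp T (co_d A i)).

Section Augment.

Definition aug_obj M (P : nat -> C) (i : nat) : C :=
  if i is j.+1 then P j else M.

Section Chain.
Variables (M : C) (P : chain_complex) (e : Hom (P 0%N) M).
Hypothesis ed : e \oc ch_d P 0 = 0.

Definition ch_aug_d i : Hom (aug_obj M P i.+1) (aug_obj M P i) :=
  if i is j.+1 then ch_d P j else e.

Lemma ch_aug_dd i : ch_aug_d i \oc ch_aug_d i.+1 = 0.
Proof. by case: i => [|i] /=; [exact: ed | exact: ch_dd]. Qed.

(* ... -> P 1 -> P 0 -> M -> 0 *)
Definition ch_augment : chain_complex := ChainComplex ch_aug_dd.
End Chain.

Section Cochain.
Variables (N : C) (Q : cochain_complex) (e : Hom N (Q 0%N)).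
Hypothesis de : co_d Q 0 \oc e = 0.

Definition co_aug_d i : Hom (aug_obj N Q i) (aug_obj N Q i.+1) :=
  if i is j.+1 then co_d Q j else e.

Lemma co_aug_dd i : co_aug_d i.+1 \oc co_aug_d i = 0.
Proof. by case: i => [|i] /=; [exact: de | exact: co_dd]. Qed.

(* 0 -> N -> Q 0 -> Q 1 -> ... *)
Definition co_augment : cochain_complex := CochainComplex co_aug_dd.
End Cochain.

End Augment.

(* The coercion to complexes gives the deleted (co)resolution; the term of
   index i of a resolution is X^{-i}. *)
Record resolution X M := Resolution {
  res_del :> chain_complex;
  res_aug : Hom (res_del 0%N) M;
  res_augd : res_aug \oc ch_d res_del 0 = 0;
  res_mem : forall i, X (res_del i);
  res_acyclic : ch_right_acyclic X (ch_augment res_augd)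
}.

Record coresolution Y N := Coresolution {
  cores_del :> cochain_complex;
  cores_aug : Hom N (cores_del 0%N);
  cores_daug : co_d cores_del 0 \oc cores_aug = 0;
  cores_mem : forall i, Y (cores_del i);
  cores_acyclic : co_left_acyclic Y (co_augment cores_daug)
}.

Definition res_complex X M (R : resolution X M) : chain_complex :=
  ch_augment (res_augd R).

(* The differential of index i of this complex is d^{i-1}, so that the
   coaugmentation d^{-1} has index 0. *)
Definition cores_complex Y N (S : coresolution Y N) : cochain_complex :=
  co_augment (cores_daug S).

(* 0 -> N -> Y^0 -> ... -> Y^n -> 0 *)
Definition has_coresolution_of_length Y N (n : nat) : Prop :=
  exists S : coresolution Y N, forall i, (n < i)%N -> is_zero (S i).

(* None stands for infinity. *)
Definition cores_dim Y N : option nat :=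
  if pselect (exists n, `[< has_coresolution_of_length Y N n >]) is left ex
  then Some (ex_minn ex) else None.

Definition dim_le (d : option nat) (n : nat) : bool :=
  if d is Some m then (m <= n)%N else false.

Definition balanced_pair X Y : Prop :=
  [/\ contravariantly_finite X, covariantly_finite Y,
      forall M, exists R : resolution X M, ch_left_acyclic Y (res_complex R)
    & forall N, exists S : coresolution Y N,
        co_right_acyclic X (cores_complex S)].

Definition admissible X : Prop :=
  forall M A (f : Hom A M), right_approximation X f -> epi f.

Definition admissible_balanced_pair X Y : Prop :=
  balanced_pair X Y /\ admissible X.

(* H^i(Hom(X^., N)), where X^. is the deleted resolution R of M *)
Definition Ext X M (R : resolution X M) (i : nat) N : zmodType :=
  if i is j.+1
  then homology (precomp N (ch_d R j)) (precomp N (ch_d R j.+1))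
  else homology (\0 : Hom (R 0%N) N -> Hom (R 0%N) N) (precomp N (ch_d R 0)).

End Relative.

(* Main.v *)
Require Import Defs.
From mathcomp Require Import all_boot all_order all_algebra.
From mathcomp Require Import boolp.
Import Defs GRing.Theory.

Set Implicit Arguments.
Unset Strict Implicit.
Unset Printing Implicit Defensive.

Local Open Scope ring_scope.

(** Balancedness makes the two acyclicity conditions interchangeable: every
    [X]-resolution is left [Y]-acyclic ([resolution_left_acyclic]) and every
    [Y]-coresolution is right [X]-acyclic ([coresolution_right_acyclic]), since
    any two resolutions of an object are homotopy equivalent and one of them has
    the property. Consequently, for an [X]-resolution [R] of [M] and a
    [Y]-coresolution [S] of [N], augmented to [N = B_0 -> B_1 -> ...], the
    double complex [Hom(R_a, B_k)] is exact in the [a] direction at the terms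
    with [a > 0] and [k > 0], and in the [k] direction at all terms.

    If [S] has length at most [n], a cocycle [R_i -> N] with [i > n] is pushed
    along a zigzag of this double complex to a vanishing term and pulled back
    to a coboundary ([Ext_vanishing]).

    If [Ext^{n+1}(-, N)] vanishes, take for [M] the cocycles of [Y^{n+1}], with
    [q : Y^n -> M] the corestriction of the differential. The augmentation
    [e : R_0 -> M] lifts to [g : R_0 -> Y^n] with [q g = e]; the zigzag of [g]
    ends with a cocycle [R_{n+1} -> N], which is a coboundary, so that [g] can
    be corrected by a map through [d^{n-1}] until it vanishes on [R_1]
    ([zigzag_correction]). It then factors as [s e], and [q s = 1] because [e]
    is an epimorphism, by admissibility. Admissibility also gives that
    [Im d^{n-1}] is the kernel of [q], hence a direct summand of [Y^n]
    ([Im_in_subcategory]).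

    If [Im d^{n-1}] lies in [Y], any coresolution of [N] can be cut off there
    ([truncate_coresolution]), which bounds the dimension. *)

(** * Preadditive categories *)

Section Additivity.
Variable C : preadditive.
Implicit Types A B D T : C.

Lemma comp0m A B D (f : Hom A B) : (0 : Hom B D) \oc f = 0.
Proof. exact: (raddf0 (precomp D f)). Qed.

Lemma compm0 A B D (f : Hom B D) : f \oc (0 : Hom A B) = 0.
Proof. exact: (raddf0 (postcomp A f)). Qed.

Lemma compBl A B D (g h : Hom B D) (f : Hom A B) :
  (g - h) \oc f = g \oc f - h \oc f.
Proof. exact: (raddfB (precomp D f)). Qed.

Lemma compBr A B D (f : Hom B D) (g h : Hom A B) :
  f \oc (g - h) = f \oc g - f \oc h.
Proof. exact: (raddfB (postcomp A f)). Qed.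

Lemma mono_eq0 A B (f : Hom A B) :
  mono f -> forall T (u : Hom T A), f \oc u = 0 -> u = 0.
Proof. by move=> fM T u fu; apply: fM; rewrite fu compm0. Qed.

Lemma epi_eq0 A B (f : Hom A B) :
  epi f -> forall T (u : Hom B T), u \oc f = 0 -> u = 0.
Proof. by move=> fE T u uf; apply: fE; rewrite uf comp0m. Qed.

Lemma eq0_epi A B (f : Hom A B) :
  (forall T (u : Hom B T), u \oc f = 0 -> u = 0) -> epi f.
Proof.
move=> f0 T u v uv; apply/eqP; rewrite -subr_eq0; apply/eqP/f0.
by rewrite compBl uv subrr.
Qed.

Lemma kernel_mono A B K (f : Hom A B) (k : Hom K A) : is_kernel f k -> mono k.
Proof.
move=> [fk kU] T u v kuv.
have [|w [_ wU]] := kU T (k \oc u); first by rewrite compA fk comp0m.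
by rewrite -(wU u) // (wU v).
Qed.

Lemma cokernel_epi A B Q (f : Hom A B) (q : Hom B Q) : is_cokernel f q -> epi q.
Proof.
move=> [qf qU] T u v quv.
have [|w [_ wU]] := qU T (u \oc q); first by rewrite -compA qf compm0.
by rewrite -(wU u) // (wU v).
Qed.

Lemma epi_cokernel_zero A B Z (f : Hom A B) :
  epi f -> is_zero Z -> is_cokernel f (0 : Hom B Z).
Proof.
move=> fE [Z0 _]; split=> [|T u uf0]; first exact: comp0m.
rewrite (epi_eq0 fE uf0).
by exists 0; split=> [|v _]; [exact: comp0m | rewrite (Z0 _ v)].
Qed.

End Additivity.

(** The opposite category, in which comparing resolutions amounts to comparing
    coresolutions. Composition and units stay convertible to the original ones,
    so that a lemma about [op C] applies to morphisms of [C] as it stands. *)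
Definition op (C : preadditive) : preadditive.
Proof.
refine (@Preadditive C (fun A B => @Hom C B A) (fun A => idm A)
  (fun A B D g f => f \oc g) _ _ _ _ _) => *.
- by rewrite compA.
- exact: compm1.
- exact: comp1m.
- exact: compDr.
- exact: compDl.
Defined.

(** * Relative exactness and comparison of resolutions *)

Section RelativeExactness.
Variables (C : preadditive) (X : C -> Prop).
Implicit Types A B D T : C.

(** Relative exactness against a class [X] of objects: [hom_surj], [hom_inj]
    and [hom_exact] say that applying [Hom(T, -)] for [T] in [X] gives a
    surjection, an injection, or a sequence with kernel contained in image; the
    [cohom_] versions concern [Hom(-, T)]. *)
Definition hom_surj A B (f : Hom A B) : Prop :=
  forall T, X T -> forall v : Hom T B, exists w, f \oc w = v.

Definition hom_inj A B (f : Hom A B) : Prop :=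
  forall T, X T -> forall v : Hom T A, f \oc v = 0 -> v = 0.

Definition hom_exact A B D (f : Hom A B) (g : Hom B D) : Prop :=
  forall T, X T -> forall v : Hom T B, g \oc v = 0 -> exists w, f \oc w = v.

Definition cohom_surj A B (f : Hom A B) : Prop :=
  forall T, X T -> forall v : Hom A T, exists w, w \oc f = v.

Definition cohom_inj A B (f : Hom A B) : Prop :=
  forall T, X T -> forall v : Hom B T, v \oc f = 0 -> v = 0.

Definition cohom_exact A B D (f : Hom A B) (g : Hom B D) : Prop :=
  forall T, X T -> forall v : Hom B T, v \oc f = 0 -> exists w, w \oc g = v.

End RelativeExactness.

(** [a1, a0] and [p1, p0] are the ends of two augmented complexes over the same
    object [M], resolving it relatively to [X]; exactness of [Hom(-, T)] is
    carried over from the second to the first. *)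
Section Comparison.
Variables (C : preadditive) (X Y : C -> Prop).
Variables (M A0 A1 P0 P1 : C).
Variables (a0 : Hom A0 M) (a1 : Hom A1 A0) (p0 : Hom P0 M) (p1 : Hom P1 P0).
Hypotheses (XA0 : X A0) (XP0 : X P0) (XP1 : X P1).
Hypotheses (a0S : hom_surj X a0) (a1E : hom_exact X a1 a0).
Hypotheses (p0S : hom_surj X p0) (pp : p0 \oc p1 = 0).

Lemma comparison_inj : cohom_inj Y p0 -> cohom_inj Y a0.
Proof.
move=> p0I T YT v va; have [g p0E] := a0S XP0 p0.
by apply: (p0I T YT); rewrite -p0E compA va comp0m.
Qed.

Lemma comparison_exact0 : cohom_exact Y p1 p0 -> cohom_exact Y a1 a0.
Proof.
move=> pE T YT u ua1.
have [g a0g] := a0S XP0 p0; have [f p0f] := p0S XA0 a0.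
have [|g1 a1g1] := a1E XP1 (v := g \oc p1); first by rewrite compA a0g.
have [|v vp0] := pE T YT (u \oc g).
  by rewrite -compA -a1g1 compA ua1 comp0m.
have [|h a1h] := a1E XA0 (v := idm A0 - g \oc f).
  by rewrite compBr compm1 compA a0g p0f subrr.
exists v; apply/esym/eqP; rewrite -subr_eq0 -p0f compA vp0 -compA.
by rewrite -[X in X - _]compm1 -compBr -a1h compA ua1 comp0m.
Qed.

(** Comparison of two [X]-resolutions in a single degree: the maps
    [f0, f1, g0, g1] between them and the homotopies [h0, h1] are the first
    terms of a homotopy equivalence over [M], and only these are needed to
    carry exactness of [Hom(-, T)] at [P1] over to [A1]. *)
Lemma comparison_exact1 (A2 P2 : C) (a2 : Hom A2 A1) (p2 : Hom P2 P1) :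
  X A1 -> X P2 -> hom_exact X a2 a1 -> hom_exact X p1 p0 ->
  a0 \oc a1 = 0 -> p1 \oc p2 = 0 ->
  cohom_exact Y p2 p1 -> cohom_exact Y a2 a1.
Proof.
move=> XA1 XP2 a2E p1E aa pp2 pE T YT u ua2.
have [g0 a0g0] := a0S XP0 p0; have [f0 p0f0] := p0S XA0 a0.
have [|g1 a1g1] := a1E XP1 (v := g0 \oc p1); first by rewrite compA a0g0.
have [|g2 a2g2] := a2E _ XP2 (g1 \oc p2).
  by rewrite compA a1g1 -compA pp2 compm0.
have [|w wp1] := pE T YT (u \oc g1).
  by rewrite -compA -a2g2 compA ua2 comp0m.
have [|h0 a1h0] := a1E XA0 (v := idm A0 - g0 \oc f0).
  by rewrite compBr compm1 compA a0g0 p0f0 subrr.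
have [|f1 p1f1] := p1E _ XA1 (f0 \oc a1); first by rewrite compA p0f0.
have [|h1 a2h1] := a2E _ XA1 (idm A1 - (g1 \oc f1 + h0 \oc a1)).
  rewrite compBr compDr compm1 !compA a1g1 a1h0 -compA p1f1.
  by rewrite compBl comp1m compA subrKC subrr.
exists (w \oc f0 + u \oc h0); rewrite compDl -!compA -p1f1 compA wp1 -compA.
apply/esym/eqP; rewrite -subr_eq0 -compDr -[X in X - _]compm1 -compBr.
by rewrite -a2h1 compA ua2 comp0m.
Qed.

End Comparison.

(** * Acyclicity of resolutions and coresolutions *)

Section Acyclicity.
Variable C : abelian.
Implicit Types (X Y : subcategory C) (M N : C).

Lemma ch_right_acyclicP X (A : chain_complex C) :
  ch_right_acyclic X A <->
  hom_surj X (ch_d A 0) /\ forall i, hom_exact X (ch_d A i.+1) (ch_d A i).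
Proof.
split=> [acA|[sA eA] T XT].
  split=> [T XT v|i T XT v]; first exact: (acA T XT).1.
  by move/((acA T XT).2 i v).
split=> [v|i v]; first exact: sA.
split=> [|[u <-]]; first exact: eA.
by rewrite /postcomp compA ch_dd comp0m.
Qed.

Lemma ch_left_acyclicP Y (A : chain_complex C) :
  ch_left_acyclic Y A <->
  cohom_inj Y (ch_d A 0) /\ forall i, cohom_exact Y (ch_d A i.+1) (ch_d A i).
Proof.
split=> [acA|[sA eA] T XT].
  split=> [T XT v|i T XT v]; first exact: (acA T XT).1.
  by move/((acA T XT).2 i v).
split=> [v|i v]; first exact: sA.
split=> [|[u <-]]; first exact: eA.
by rewrite /precomp -compA ch_dd compm0.
Qed.

Lemma co_left_acyclicP Y (A : cochain_complex C) :
  co_left_acyclic Y A <->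
  cohom_surj Y (co_d A 0) /\ forall i, cohom_exact Y (co_d A i) (co_d A i.+1).
Proof.
split=> [acA|[sA eA] T XT].
  split=> [T XT v|i T XT v]; first exact: (acA T XT).1.
  by move/((acA T XT).2 i v).
split=> [v|i v]; first exact: sA.
split=> [|[u <-]]; first exact: eA.
by rewrite /precomp -compA co_dd compm0.
Qed.

Lemma co_right_acyclicP X (A : cochain_complex C) :
  co_right_acyclic X A <->
  hom_inj X (co_d A 0) /\ forall i, hom_exact X (co_d A i) (co_d A i.+1).
Proof.
split=> [acA|[sA eA] T XT].
  split=> [T XT v|i T XT v]; first exact: (acA T XT).1.
  by move/((acA T XT).2 i v).
split=> [v|i v]; first exact: sA.
split=> [|[u <-]]; first exact: eA.
by rewrite /postcomp compA co_dd comp0m.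
Qed.

Lemma resolution_left_acyclic X Y M (R : resolution X M) :
  balanced_pair X Y -> ch_left_acyclic Y (res_complex R).
Proof.
case=> _ _ resX _; apply/ch_left_acyclicP.
have [sR eR] := (ch_right_acyclicP _ _).1 (res_acyclic R).
have [P /ch_left_acyclicP[iP cP]] := resX M.
have [sP eP] := (ch_right_acyclicP _ _).1 (res_acyclic P).
have RX := res_mem R; have PX := res_mem P.
split=> [|[|[|i]]].
- exact: comparison_inj (PX 0) sR iP.
- exact: comparison_exact0 (RX 0) (PX 0) (PX 1) sR (eR 0) sP (res_augd P) (cP 0).
- exact: (comparison_exact1 (RX 0) (PX 0) (PX 1) sR (eR 0) sP (res_augd P)
    (RX 1) (PX 2) (eR 1) (eP 0) (res_augd R) (ch_dd P 0) (cP 1)).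
(* In higher degrees, the part of A from index i.+2 on resolves the kernel of
   ch_d A i; compare it with a left acyclic resolution of that kernel. *)
set A := res_complex R.
have [dk kU] := kerP (ch_d A i).
have kM := kernel_mono (kerP (ch_d A i)).
have [a [ka _]] := kU _ _ (ch_dd A i).
have [Q /ch_left_acyclicP[_ cQ]] := resX (Ker (ch_d A i)).
have [sQ eQ] := (ch_right_acyclicP _ _).1 (res_acyclic Q).
have QX := res_mem Q.
have aS : hom_surj X a.
  move=> T XT v; have [|w dw] := eR i T XT (ker (ch_d A i) \oc v).
    by rewrite compA dk comp0m.
  by exists w; apply: kM; rewrite compA ka.
have aE : hom_exact X (ch_d A i.+2) a.
  move=> T XT v av; apply: (eR i.+1 T XT v).
  by rewrite -[ch_d _ _]ka -compA av compm0.
have aa : a \oc ch_d A i.+2 = 0.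
  by apply: (mono_eq0 kM); rewrite compA ka ch_dd.
exact: (comparison_exact1 (RX i.+1) (QX 0) (QX 1) aS aE sQ (res_augd Q)
  (RX i.+2) (QX 2) (eR i.+2) (eQ 0) aa (ch_dd Q 0) (cQ 1)).
Qed.

Lemma coresolution_right_acyclic X Y N (S : coresolution Y N) :
  balanced_pair X Y -> co_right_acyclic X (cores_complex S).
Proof.
case=> _ _ _ coresY; apply/co_right_acyclicP.
have [sS eS] := (co_left_acyclicP _ _).1 (cores_acyclic S).
have [P /co_right_acyclicP[iP cP]] := coresY N.
have [sP eP] := (co_left_acyclicP _ _).1 (cores_acyclic P).
have SY := cores_mem S; have PY := cores_mem P.
split=> [|[|[|i]]].
- exact: (comparison_inj (C := op C) (PY 0) sS iP).
- exact: (comparison_exact0 (C := op C) (SY 0) (PY 0) (PY 1) sS (eS 0) sP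
    (cores_daug P) (cP 0)).
- exact: (comparison_exact1 (C := op C) (SY 0) (PY 0) (PY 1) sS (eS 0) sP
    (cores_daug P) (SY 1) (PY 2) (eS 1) (eP 0)
    (cores_daug S) (co_dd P 0) (cP 1)).
set A := cores_complex S.
have [qd qU] := cokerP (co_d A i).
have qE := cokernel_epi (cokerP (co_d A i)).
have [a [aq _]] := qU _ _ (co_dd A i).
have [Q /co_right_acyclicP[_ cQ]] := coresY (Coker (co_d A i)).
have [sQ eQ] := (co_left_acyclicP _ _).1 (cores_acyclic Q).
have QY := cores_mem Q.
have aS : cohom_surj Y a.
  move=> T YT v; have [|w wd] := eS i T YT (v \oc coker (co_d A i)).
    by rewrite -compA qd compm0.
  by exists w; apply: qE; rewrite -compA aq.
have aE : cohom_exact Y a (co_d A i.+2).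
  move=> T YT v va; apply: (eS i.+1 T YT v).
  by rewrite -[co_d _ _]aq compA va comp0m.
have aa : co_d A i.+2 \oc a = 0.
  by apply: (epi_eq0 qE); rewrite -compA aq co_dd.
exact: (comparison_exact1 (C := op C) (SY i.+1) (QY 0) (QY 1) aS aE sQ
  (cores_daug Q) (SY i.+2) (QY 2) (eS i.+2) (eQ 0) aa
  (co_dd Q 0) (cQ 1)).
Qed.

End Acyclicity.

(** * Vanishing of relative extension groups *)

Section Vanishing.
Variable C : abelian.
Implicit Types (X Y : subcategory C) (M N : C).

Lemma Ext_eq0 X M (R : resolution X M) i N :
  (forall x : Ext R i.+1 N, x = 0) <->
  (forall u : Hom (R i.+1) N, u \oc ch_d R i.+1 = 0 ->
     exists v, v \oc ch_d R i = u).
Proof. exact: homology_eq0. Qed.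

(** Each step to the right in [B] lowers the degree in [R] by one: after [j + 1]
    steps [g] has become a map [R_a -> B_{j+k+1}], which is a cocycle because
    the next term of [B] is zero, hence lifts to [B_{j+k}]; the lift is the
    correction that allows the last step to be undone, and so on back to [g]. *)
Lemma zigzag_zero X Y M (R : resolution X M) (B : cochain_complex C) :
  (forall k, Y (B k.+1)) -> (forall i, cohom_exact Y (ch_d R i.+1) (ch_d R i)) ->
  (forall k, hom_exact X (co_d B k) (co_d B k.+1)) ->
  forall j a k, is_zero (B (j + k).+2) ->
  forall g : Hom (R (j + a).+1) (B k),
    co_d B k \oc (g \oc ch_d R (j + a).+1) = 0 ->
  exists w, co_d B k \oc (w \oc ch_d R (j + a)) = co_d B k \oc g.
Proof.
move=> BY cR eB; have RX := res_mem R.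
elim=> [|j IHj] a k B0 g; rewrite compA => /(cR _ _ (BY k))[v vd].
  have [|w dw] := eB k _ (RX _) v; first exact: B0.2.
  by exists w; rewrite compA dw.
have [||w dw] := IHj a k.+1 _ v.
- by rewrite addnS.
- by rewrite vd compA co_dd comp0m.
have [|w' dw'] := eB k _ (RX _) (v - w \oc ch_d R (j + a)).
  by rewrite compBr dw subrr.
exists w'; rewrite compA dw' compBl vd -compA.
by rewrite (ch_dd R (j + a)) compm0 subr0.
Qed.

Lemma Ext_vanishing X Y M N (R : resolution X M) n i :
  balanced_pair X Y -> has_coresolution_of_length Y N n -> (n < i)%N ->
  forall x : Ext R i N, x = 0.
Proof.
move=> XY [S S0] lt_ni.
have -> : i = (n + (i - n.+1)).+1 by rewrite -addSn subnKC.
apply/Ext_eq0 => u ud.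
have [_ cR] := (ch_left_acyclicP _ _).1 (resolution_left_acyclic R XY).
have [iS eS] := (co_right_acyclicP _ _).1 (coresolution_right_acyclic S XY).
have [||||w dw] := zigzag_zero (Y := Y) (B := cores_complex S) _ _ eS
    (j := n) (a := i - n.+1) (k := 0) _ (g := u).
- by move=> k; apply: cores_mem.
- by move=> k; apply: (cR k.+1).
- by apply: S0; rewrite addn0.
- by rewrite ud compm0.
exists w; apply/eqP; rewrite -subr_eq0; apply/eqP.
by apply: (iS _ (res_mem R _)); rewrite compBr dw subrr.
Qed.

(** The zigzag read backwards: the vanishing of [Ext] at the bottom of the
    coresolution lets the defect [g d_a] be absorbed by a correction [d_k w]. *)
Lemma zigzag_correction X Y M N (R : resolution X M) (S : coresolution Y N) n :
  balanced_pair X Y -> (forall x : Ext R n.+1 N, x = 0) ->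
  forall k a, (a + k)%N = n ->
  forall g : Hom (R a) (cores_complex S k.+1),
    co_d (cores_complex S) k.+1 \oc (g \oc ch_d R a) = 0 ->
  exists w, co_d (cores_complex S) k \oc (w \oc ch_d R a) = g \oc ch_d R a.
Proof.
move=> XY /Ext_eq0 Ext0.
have [_ cR] := (ch_left_acyclicP _ _).1 (resolution_left_acyclic R XY).
have [iS eS] := (co_right_acyclicP _ _).1 (coresolution_right_acyclic S XY).
elim=> [|k IHk] a ak g /(eS _ _ (res_mem R _))[g' dg'].
  rewrite addn0 in ak; subst a; have [|w wd] := Ext0 g'.
    apply: (iS _ (res_mem R _)).
    by rewrite compA dg' -compA ch_dd compm0.
  by exists w; rewrite wd.
have [||w dw] := IHk a.+1 _ g'.
- by rewrite addSnnS.
- by rewrite compA dg' -compA ch_dd compm0.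
have [|w' wd'] :=
    cR a.+1 _ (cores_mem S k) (g' - co_d (cores_complex S) k \oc w).
  by rewrite compBl -compA dw subrr.
exists w'; rewrite [w' \oc _]wd' compBr dg' compA.
by rewrite (co_dd (cores_complex S) k) comp0m subr0.
Qed.

Lemma Im_in_subcategory X Y N (S : coresolution Y N) n
    (res : forall M : C, resolution X M) :
  admissible_balanced_pair X Y ->
  (forall M (x : Ext (res M) n.+1 N), x = 0) ->
  Y (Im (co_d (cores_complex S) n)).
Proof.
move=> [XY adm] Ext0; set B := cores_complex S; set dn := co_d B n.
have [_ eB] := (co_right_acyclicP _ _).1 (coresolution_right_acyclic S XY).
have resE M : epi (res_aug (res M)).
  have [sR _] := (ch_right_acyclicP _ _).1 (res_acyclic (res M)).
  by apply: adm; split=> [|A g XA]; [exact: res_mem | exact: sR].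
(* The term of index n.+1 of B is Y^n, and dn is the differential ending there.
   M is the object of cocycles of Y^{n+1}. *)
set iota : Hom (Im dn) _ := ker (coker dn).
have [coker_iota iotaU] := kerP (coker dn).
have iotaM : mono iota := kernel_mono (kerP (coker dn)).
set M := Ker (co_d B n.+2); set j : Hom M _ := ker (co_d B n.+2).
have [dj jU] := kerP (co_d B n.+2).
have jM : mono j := kernel_mono (kerP (co_d B n.+2)).
have [q [jq _]] := jU _ _ (co_dd B n.+1).
have qdn : q \oc dn = 0.
  by apply: (mono_eq0 jM); rewrite compA jq co_dd.
have q_iota : q \oc iota = 0.
  have [c [cE _]] := (cokerP dn).2 _ q qdn.
  by rewrite -cE -compA coker_iota compm0.
(* The kernel of q is Im dn: it suffices to check this after an epimorphism from
   an object of X, where right acyclicity applies. *)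
have qker T (y : Hom T (B n.+1)) : q \oc y = 0 -> exists r, iota \oc r = y.
  move=> qy; have [|r [rE _]] := iotaU _ y; last by exists r.
  apply: (resE T); rewrite comp0m.
  have [|x dx] := eB n _ (res_mem (res T) 0) (y \oc res_aug (res T)).
    by rewrite -jq -compA [q \oc _]compA qy comp0m compm0.
  by rewrite -compA -dx compA (cokerP dn).1 comp0m.
(* A section of q: lift the augmentation of a resolution of M to Y^n and correct
   it to a map that factors through the augmentation. *)
have [s qs] : exists s : Hom M (B n.+1), q \oc s = idm M.
  set R := res M; set e := res_aug R.
  have [_ cR] := (ch_left_acyclicP _ _).1 (resolution_left_acyclic R XY).
  have [|g dg] := eB n.+1 _ (res_mem R 0) (j \oc e).
    by rewrite compA dj comp0m.
  have qg : q \oc g = e by apply: jM; rewrite compA jq.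
  have [||w dw] :=
      zigzag_correction (S := S) XY (Ext0 M) (k := n) (a := 0) _ (g := g).
  - by [].
  - by rewrite compA dg -compA (res_augd R) compm0.
  have [|s se] := cR 0 _ (cores_mem S n) (g - dn \oc w).
    by rewrite compBl -compA dw subrr.
  exists s; apply: (resE M); rewrite comp1m -compA [s \oc _]se.
  by rewrite compBr qg compA qdn comp0m subr0.
have [r ir] : exists r, iota \oc r = idm (B n.+1) - s \oc q.
  by apply: qker; rewrite compBr compm1 compA qs comp1m subrr.
apply: (@sub_summand _ Y (Im dn) M (B n.+1)); last exact: cores_mem.
exists iota, s, r, q; split=> //; last by rewrite ir subrK.
- apply: iotaM; rewrite compA ir compBl comp1m compm1 -compA q_iota compm0.
  by rewrite subr0.
- apply: (mono_eq0 iotaM).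
  by rewrite compA ir compBl comp1m -compA qs compm1 subrr.
Qed.

End Vanishing.

(** * Truncation of coresolutions *)

Section Truncation.
Variable C : abelian.
Implicit Types (Y : subcategory C) (M N : C).

Lemma Im_factor (A B : C) (f : Hom A B) :
  exists p : Hom A (Im f), ker (coker f) \oc p = f /\ epi p.
Proof.
have [p [ip _]] := (kerP (coker f)).2 _ _ (cokerP f).1.
exists p; split=> //; apply: eq0_epi => T u up.
have iM := kernel_mono (kerP (coker f)).
(* Im f is the smallest subobject through which f factors, so Ker u is all
   of it. *)
have kM := kernel_mono (kerP u).
have [|D [g [gm gU]]] := @mono_normal C _ _ (ker (coker f) \oc ker u).
  by move=> S v w; rewrite -!compA => /iM/kM.
have [p' [kp' _]] := (kerP u).2 _ _ up.
have [|c [cE _]] := (cokerP f).2 _ g.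
  by rewrite -ip -kp' compA compA -[g \oc _ \oc _]compA gm comp0m.
have [|t [mt _]] := gU _ (ker (coker f)).
  by rewrite -cE -compA (kerP (coker f)).1 compm0.
have kt : ker u \oc t = idm _ by apply: iM; rewrite compA mt compm1.
by rewrite -[u]compm1 -kt compA (kerP u).1 comp0m.
Qed.

Section Tail.
Variables (Y : subcategory C) (N N1 : C) (S : coresolution Y N).
Variables (q : Hom (S 0) N1) (c : Hom N1 (S 1)).
Hypotheses (qP : is_cokernel (cores_aug S) q) (cq : c \oc q = co_d S 0).

Let qE : epi q := cokernel_epi qP.

Definition tail_complex : cochain_complex C :=
  CochainComplex (fun i => co_dd S i.+1).

Lemma tail_daug : co_d tail_complex 0 \oc c = 0.
Proof. by apply: (epi_eq0 qE); rewrite -compA cq co_dd. Qed.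

Lemma tail_acyclic : co_left_acyclic Y (co_augment tail_daug).
Proof.
have [_ eS] := (co_left_acyclicP _ _).1 (cores_acyclic S).
apply/co_left_acyclicP; split=> [T YT v|[|i] T YT v].
- have [|w wd] := eS 0 T YT (v \oc q); first by rewrite -compA qP.1 compm0.
  by exists w; apply: qE; rewrite -compA cq.
- by move=> vc; apply: (eS 1 T YT v); rewrite -[co_d _ _]cq compA vc comp0m.
- exact: (eS i.+2 T YT v).
Qed.

(** The coresolution [0 -> N1 -> S^1 -> S^2 -> ...] of the cokernel [N1] of the
    coaugmentation of [S]; its coaugmentation [c] is the map induced by the
    first differential of [S]. *)
Definition tail : coresolution Y N1 :=
  @Coresolution C Y N1 tail_complex c tail_daug
    (fun i => cores_mem S i.+1) tail_acyclic.

End Tail.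

Lemma zero_coresolution Y (Z : C) :
  is_zero Z -> exists S : coresolution Y Z, forall i, is_zero (S i).
Proof.
move=> Z0.
pose D := @CochainComplex C (fun _ => Z) (fun _ => 0) (fun _ => comp0m _ 0).
have D0 : co_d D 0 \oc (0 : Hom Z (D 0)) = 0 by exact: comp0m.
have DA : co_left_acyclic Y (co_augment D0).
  apply/co_left_acyclicP; split=> [T _ v|[|i] T _ v _]; exists 0.
  - by rewrite [v]Z0.1 comp0m.
  - by rewrite [v]Z0.1 comp0m.
  - by rewrite [v]Z0.1 comp0m.
by exists (@Coresolution C Y Z D 0 D0 (fun _ => sub_zero Y Z0) DA).
Qed.

Lemma splice_coresolution Y N B N1 (e : Hom N B) (q : Hom B N1)
    (S : coresolution Y N1) :
  Y B -> cohom_surj Y e -> is_cokernel e q ->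
  exists S' : coresolution Y N, forall i, is_zero (S i) -> is_zero (S' i.+1).
Proof.
move=> YB eS qP; have qE := cokernel_epi qP.
have [sS cS] := (co_left_acyclicP _ _).1 (cores_acyclic S).
have Dd : co_d S 0 \oc (cores_aug S \oc q) = 0.
  by rewrite compA cores_daug comp0m.
pose D := co_augment Dd.
have De : co_d D 0 \oc e = 0 by rewrite /= -compA qP.1 compm0.
have DY i : Y (D i) by case: i => [|i] //; exact: cores_mem.
have DA : co_left_acyclic Y (co_augment De).
  apply/co_left_acyclicP; split=> [|[|[|i]] T YT v vd]; first exact: eS.
  - have [w [wq _]] := qP.2 _ v vd; have [x xa] := sS T YT w.
    by exists x; rewrite /= compA [x \oc _]xa.
  - by apply: (cS 0 T YT v); apply: qE; rewrite comp0m -compA.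
  - exact: (cS i.+1 T YT v).
by exists (@Coresolution C Y N D e De DY DA).
Qed.

(** A coresolution may be cut off where its differential factors as an
    epimorphism followed by a monomorphism through an object of [Y]. The
    induction replaces [S] by its tail and glues its first term back on. *)
Lemma truncate_coresolution Y n : forall N (S : coresolution Y N) K
    (p : Hom (cores_complex S n) K) (j : Hom K (cores_complex S n.+1)),
  epi p -> mono j -> j \oc p = co_d (cores_complex S) n -> Y K ->
  has_coresolution_of_length Y N n.
Proof.
elim: n => [|n IHn] N S K p j pE jM jp YK.
  have [sS _] := (co_left_acyclicP _ _).1 (cores_acyclic S).
  have [Z Z0] := zero_ex C; have [S0 S0Z] := zero_coresolution Y Z0.
  have [|S' S'0] := splice_coresolution S0 YK _ (epi_cokernel_zero pE Z0).
    move=> T YT v; have [w wd] := sS T YT v.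
    by exists (w \oc j); rewrite -compA jp.
  by exists S' => -[|i] // _; exact: S'0.
have qP := cokerP (cores_aug S); set q := coker _ in qP.
have qE := cokernel_epi qP.
have [c [cq _]] := qP.2 _ _ (cores_daug S).
suff [S1 S1Z] : has_coresolution_of_length Y (Coker (cores_aug S)) n.
  have [sS _] := (co_left_acyclicP _ _).1 (cores_acyclic S).
  have [S' S'0] := splice_coresolution S1 (cores_mem S 0) sS qP.
  by exists S' => -[|i] // lt_ni; apply/S'0/S1Z.
case: n => [|n] in IHn p j pE jM jp *; last exact: (IHn _ (tail qP cq) K p j).
(* For n = 0 the differential of the tail is not that of S but the map induced
   on the cokernel, through which p factors. *)
have [|p1 [p1q _]] := qP.2 _ p.
  by apply: (mono_eq0 jM); rewrite compA jp (cores_daug S).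
apply: (IHn _ (tail qP cq) K p1 j) => //.
  apply: eq0_epi => T u up1; apply: (epi_eq0 pE).
  by rewrite -p1q compA up1 comp0m.
by apply: qE; rewrite -compA p1q jp cq.
Qed.

End Truncation.

(** * The coresolution dimension *)

Lemma dim_leP (C : abelian) (Y : subcategory C) (N : C) n :
  dim_le (cores_dim Y N) n <->
  exists2 m, (m <= n)%N & has_coresolution_of_length Y N m.
Proof.
rewrite /cores_dim; case: pselect => [ex|nex] /=.
  case: ex_minnP => m /asboolP Sm min_m; split=> [le_mn|[k le_kn Sk]].
    by exists m.
  by apply: leq_trans le_kn; apply/min_m/asboolP.
by split=> // -[m _ Sm]; case: nex; exists m; apply/asboolP.
Qed.

Theorem theorem4p8 (C : abelian) (X Y : subcategory C)
    (XY : admissible_balanced_pair X Y)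
    (res : forall M : C, resolution X M) (N : C) (n : nat) :
  [<-> dim_le (cores_dim Y N) n;
       forall i : nat, (n.+1 <= i)%N ->
         forall (M : C) (x : Ext (res M) i N), x = 0;
       forall (M : C) (x : Ext (res M) n.+1 N), x = 0;
       forall S : coresolution Y N, Y (Im (co_d (cores_complex S) n))].
Proof.
tfae.
- move/dim_leP=> [m le_mn Sm] i lt_ni M.
  exact: Ext_vanishing XY.1 Sm (leq_ltn_trans le_mn lt_ni).
- by move=> Ext0 M; apply: Ext0.
- by move=> Ext0 S; apply: Im_in_subcategory Ext0.
- move=> YIm; apply/dim_leP; exists n => //.
  have [_ _ _ /(_ N)[S _]] := XY.1.
  have [p [jp pE]] := Im_factor (co_d (cores_complex S) n).
  exact: truncate_coresolution pE (kernel_mono (kerP _)) jp (YIm S).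
Qed.
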